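(* Let $d\ge1$ be fixed and let $\{Y_{i,n}\}_{1\le i\le n,\ n\ge1}$ be a triangular array of random vectors in $\mathbb{R}^d$ (no independence is assumed). Let $\mu_n=\frac1n\sum_{i=1}^n\delta_{Y_{i,n}}$ and $\bar\mu_n=\mathbb{E}[\mu_n]$. Assume there exists a sequence of real numbers $r_n\ge2$ with $r_n\to\infty$ such that for every unit vector $\theta\in S^{d-1}$: (a) (Uniform projected tails) there is a constant $\zeta(\theta)<\infty$, not depending on $n$, such that $\sup_{1\le i\le n}\|\langle\theta,Y_{i,n}\rangle\|_{\Psi_{r_n}}\le\zeta(\theta)$ for every $n$; (b) (Projected moment concentration) for every fixed integer $k\ge1$, $$\operatorname{Var}\Bigl(\frac1n\sum_{i=1}^n\langle\theta,Y_{i,n}\rangle^k\Bigr)\to0\quad\text{as } n\to\infty;$$ and moreover (c) (Bounded first moment) $\sup_{n\ge1}M_1(\bar\mu_n)<\infty$. Then $\mathbb{E}\bigl[W_1(\mu_n,\bar\mu_n)\bigr]\to0$ as $n\to\infty$.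
   Context: For each $n$, the vectors $Y_{1,n},\dots,Y_{n,n}$ are defined on a common probability space. The expected measure $\bar\mu_n=\mathbb{E}[\mu_n]$ is the deterministic probability measure on $\mathbb{R}^d$ given by $\bar\mu_n(A)=\mathbb{E}[\mu_n(A)]$ for Borel sets $A$. $\|\cdot\|$ and $\langle\cdot,\cdot\rangle$ are the Euclidean norm and inner product on $\mathbb{R}^d$, and $S^{d-1}$ is the Euclidean unit sphere. The absolute first moment of a measure $\mu$ on $\mathbb{R}^d$ is $M_1(\mu)=\int\|x\|\,d\mu(x)$. The 1-Wasserstein distance between probability measures $\mu,\nu$ on $\mathbb{R}^d$ is $W_1(\mu,\nu)=\sup_f\left|\int f\,d\mu-\int f\,d\nu\right|$, the supremum being over functions $f:\mathbb{R}^d\to\mathbb{R}$ that are $1$-Lipschitz for the Euclidean norm. For a real number $r\ge2$, let $\Psi_r(x)=\sum_{j=1}^{\lfloor r/2\rfloor}\frac{x^{2j}}{j!}$. The $\Psi_r$ norm of a real random variable $X$ is $\|X\|_{\Psi_r}=\inf\{K>0:\mathbb{E}[\Psi_r(|X|/K)]\le1\}$. Condition (b) is asymptotic in $n$: for each fixed $\theta$ and $k$ it only concerns all sufficiently large $n$. *)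

(* Defs.v *)
From HB Require Import structures.
From mathcomp Require Import all_boot all_order all_algebra.
From mathcomp Require Import all_classical all_reals all_analysis.
From mathcomp Require Import measurable_realfun.

Set Implicit Arguments.
Unset Strict Implicit.
Unset Printing Implicit Defensive.

Import Order.TTheory GRing.Theory Num.Theory.
Import numFieldNormedType.Exports.

Local Open Scope classical_set_scope.
Local Open Scope ring_scope.

(* R^d with its Borel sigma-algebra.  The library topology on ['rV[R]_d] comes
   from the sup norm, which induces the same open sets as the Euclidean norm. *)
Notation borel_rV R d := (g_sigma_algebraType (@open 'rV[R]_d)).

Section euclidean.
Context {R : realType} {d : nat}.
Implicit Types x y : 'rV[R]_d.

Definition dot x y : R := \sum_(j < d) x ord0 j * y ord0 j.

(* The library norm [`|x|] on ['rV[R]_d] is the sup norm, hence this one. *)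
Definition enorm x : R := Num.sqrt (dot x x).

Definition lipschitz1 (f : 'rV[R]_d -> R) : Prop :=
  forall x y, `|f x - f y| <= enorm (x - y).

End euclidean.

Section measures_on_Rd.
Local Open Scope ereal_scope.
Context {R : realType} {d : nat}.
Implicit Types mu nu : {measure set (borel_rV R d) -> \bar R}.

Definition M1 mu : \bar R := \int[mu]_x (enorm x)%:E.

(* If [mu] and [nu] are finite measures with finite first moments, then
   1-Lipschitz functions are integrable and the differences are real numbers. *)
Definition W1 mu nu : \bar R :=
  ereal_sup [set `| \int[mu]_x (f x)%:E - \int[nu]_x (f x)%:E |
            | f in [set f : 'rV[R]_d -> R | lipschitz1 f]].

End measures_on_Rd.

Section empirical.
Local Open Scope ereal_scope.
Context {R : realType} {d n : nat}.

Definition empirical_measure (y : 'I_n -> borel_rV R d)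
    (A : set (borel_rV R d)) : \bar R :=
  (n%:R^-1)%:E * \sum_(i < n) \d_(y i) A.

Section is_measure.
Variable y : 'I_n -> borel_rV R d.

Let empirical_measure0 : empirical_measure y set0 = 0.
Proof.
by rewrite /empirical_measure big1 ?mule0// => i _; rewrite measure0.
Qed.

Let empirical_measure_ge0 A : 0 <= empirical_measure y A.
Proof.
by rewrite /empirical_measure mule_ge0 ?lee_fin ?invr_ge0// sume_ge0.
Qed.

Let empirical_measure_sigma_additive :
  semi_sigma_additive (empirical_measure y).
Proof.
move=> F mF tF mUF; rewrite /empirical_measure.
rewrite [X in X @ \oo --> _](_ : _ = (fun k => (n%:R^-1)%:E *
    \sum_(i < n) \sum_(0 <= j < k) \d_(y i) (F j))); last first.
  apply/funext => k; rewrite exchange_big/= ge0_sume_distrr// => j _.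
  exact: sume_ge0.
apply: cvgeZl => //; apply: cvg_nnesum => [i _|i _].
  by apply: nearW => k; exact: sume_ge0.
exact: measure_semi_sigma_additive.
Qed.

HB.instance Definition _ := isMeasure.Build _ _ _ (empirical_measure y)
  empirical_measure0 empirical_measure_ge0 empirical_measure_sigma_additive.

End is_measure.

Context {disp : measure_display} {T : measurableType disp}.
Variables (P : probability T R) (Y : 'I_n -> {RV P >-> borel_rV R d}).

Definition random_empirical_measure (w : T) :
  {measure set (borel_rV R d) -> \bar R} := empirical_measure (Y ^~ w).

Definition mean_empirical_measure (A : set (borel_rV R d)) : \bar R :=
  \int[P]_w random_empirical_measure w A.

Lemma measurable_empirical_measure A : measurable A ->
  measurable_fun [set: T] (random_empirical_measure ^~ A).
Proof.
move=> mA; apply: measurable_funeM; apply: emeasurable_sum => i.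
exact: (measurableT_comp (measurable_fun_dirac mA)).
Qed.

Let mean0 : mean_empirical_measure set0 = 0.
Proof. by rewrite /mean_empirical_measure integral0_eq. Qed.

Let mean_ge0 A : 0 <= mean_empirical_measure A.
Proof. by rewrite /mean_empirical_measure integral_ge0. Qed.

Let mean_sigma_additive : semi_sigma_additive mean_empirical_measure.
Proof.
move=> F mF tF mUF; rewrite [X in _ --> X](_ : _ =
    \int[P]_w \sum_(0 <= k <oo) random_empirical_measure w (F k)); last first.
  apply: eq_integral => w _.
  by apply/esym/cvg_lim => //; exact: measure_sigma_additive.
rewrite [X in X @ _](_ : _ =
    (fun k => \int[P]_w \sum_(0 <= i < k) random_empirical_measure w (F i)));
  last first.
  apply/funext => k; rewrite -ge0_integral_sum//.
  by move=> ?; exact: measurable_empirical_measure.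
apply: cvg_monotone_convergence => //.
- by move=> k; apply: emeasurable_sum => m; exact: measurable_empirical_measure.
- by move=> k w _; rewrite sume_ge0.
- by move=> w _ k m km; exact: ereal_nondecreasing_series.
Qed.

HB.instance Definition _ := isMeasure.Build _ _ _ mean_empirical_measure
  mean0 mean_ge0 mean_sigma_additive.

End empirical.

Section psi_norm.
Context {R : realType}.

Definition Psi (r x : R) : R :=
  \sum_(1 <= j < (Num.truncn (r / 2)).+1) x ^+ (2 * j) / (j`!)%:R.

(* The value is [+oo] when no [K] is admissible. *)
Definition Psi_norm {disp : measure_display} {T : measurableType disp}
    (P : probability T R) (r : R) (X : T -> R) : \bar R :=
  ereal_inf [set K%:E | K in
    [set K : R | 0 < K /\ ('E_P[fun w => Psi r (`|X w| / K)] <= 1)%E]].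

End psi_norm.

(* Main.v *)
(* Write [Z_n g = n^-1 * \sum_i g (Y_i)].  Call [g] concentrated if [Z_n g] is
   within [o(1)] of a constant in [L^1].  Condition (b) makes the powers of
   [<theta, x>] concentrated, and (a) makes the moments of [<theta, Y_i>]
   sub-Gaussian up to an order that tends to infinity, so that replacing the
   cosine or the sine of [<t, x>] by a Taylor polynomial costs arbitrarily
   little in [L^1]; hence trigonometric polynomials are concentrated.  A random
   walk with steps [+-e_j] of probability [(1 +- sin (x_j / M)) / (2 d)] gives
   a finite partition of unity [chi_k] by nonnegative trigonometric polynomials,
   with nodes [a_k], such that [\sum_k chi_k x * |x - a_k|] is at most [eps]
   plus a small multiple of [|x|^2].  Every 1-Lipschitz [f] is thus approximated
   by [f 0 + \sum_k (f (a_k) - f 0) chi_k], with an error whose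
   mean is uniformly small because second moments are bounded; as
   [|f (a_k) - f 0| <= |a_k|], the supremum over [f] is controlled by the
   finitely many [Z_n chi_k]. *)

Require Import Defs.
From HB Require Import structures.
From mathcomp Require Import all_boot all_order all_algebra.
From mathcomp Require Import all_classical all_reals all_analysis.
From mathcomp Require Import measurable_realfun ring lra.

Set Implicit Arguments.
Unset Strict Implicit.
Unset Printing Implicit Defensive.

Import Order.TTheory GRing.Theory Num.Theory.
Import numFieldNormedType.Exports.

Local Open Scope classical_set_scope.
Local Open Scope ring_scope.

(** * Taylor polynomials of sine and cosine *)

Section taylor.
Context {R : realType}.
Implicit Types (p q : {poly R}) (k : nat).

Lemma antiderivative_poly p : exists2 q, q^`()%R = p & q.[0] = 0.
Proof.
(* At [i = 0] the quotient by [0%:R] is 0, so the constant term vanishes as required. *)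
exists (\poly_(i < (size p).+1) (p`_i.-1 / i%:R)).
  apply/polyP => i; rewrite coef_deriv coef_poly ltnS.
  case: ltnP => [_|/(nth_default 0) ->]; last by rewrite mul0rn.
  by rewrite -(mulr_natr (p`_i / i.+1%:R)) divfK ?pnatr_eq0.
by rewrite horner_coef0 coef_poly/= invr0 mulr0.
Qed.

(** Monotonicity replaces integration: the bound minus [h] vanishes at 0 and has a nonnegative
    derivative for positive arguments. *)
Let growth (h dh : R -> R) k : (forall x : R, is_derive x 1 h (dh x)) ->
  h 0 = 0 -> (forall x : R, 0 <= x -> dh x <= x ^+ k / k`!%:R) ->
  forall x : R, 0 <= x -> h x <= x ^+ k.+1 / k.+1`!%:R.
Proof.
move=> hdh h0 dhk x x0.
pose p : {poly R} := k.+1`!%:R^-1 *: 'X^(k.+1).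
pose g y := p.[y] - h y.
have dg (y : R) : is_derive y 1 g (y ^+ k / k`!%:R - dh y).
  rewrite (_ : y ^+ k / k`!%:R = p^`().[y]); first exact: is_deriveB.
  rewrite /p derivZ derivXn hornerZ hornerMn hornerXn/=.
  rewrite -(mulr_natr (y ^+ k)) factS natrM invfM [RHS]mulrC mulrA.
  by rewrite mulfK// pnatr_eq0.
have gE y : g y = y ^+ k.+1 / k.+1`!%:R - h y by rewrite /g !hornerE mulrC.
rewrite -subr_ge0 -gE (_ : 0 = g 0); last first.
  by rewrite gE h0 expr0n/= mul0r subr0.
apply: (@ger0_derive1_ndecry _ g 0) => // [y|].
- rewrite in_itv/= andbT => y0.
  by rewrite derive1E derive_val subr_ge0 dhk// ltW.
- apply: continuous_subspaceT => y.
  by apply/differentiable_continuous/derivable1_diffP; exact: ex_derive.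
Qed.

(** For [x >= 0], [growth] is applied to [h] and to its opposite; negative arguments follow by
    reflection through the origin. *)
Lemma le_normr_antiderivative (h dh : R -> R) k :
  (forall x : R, is_derive x 1 h (dh x)) -> h 0 = 0 ->
  (forall x, `|dh x| <= `|x| ^+ k / k`!%:R) ->
  forall x, `|h x| <= `|x| ^+ k.+1 / k.+1`!%:R.
Proof.
move=> hdh h0 dhk.
have pos (f df : R -> R) : (forall x : R, is_derive x 1 f (df x)) -> f 0 = 0 ->
    (forall x, `|df x| <= `|x| ^+ k / k`!%:R) ->
    forall x, 0 <= x -> `|f x| <= `|x| ^+ k.+1 / k.+1`!%:R.
  move=> fdf f0 dfk x x0; rewrite (ger0_norm x0) ler_norml lerNl.
  apply/andP; split.
    apply: (@growth (\- f) (\- df)) => // [|y y0]; first by rewrite /= f0 oppr0.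
    by rewrite (le_trans (ler_norm _))// normrN (le_trans (dfk y))// ger0_norm.
  apply: (@growth f df) => // y y0.
  by rewrite (le_trans (ler_norm _))// (le_trans (dfk y))// ger0_norm.
move=> x; have [x0|/ltW x0] := leP 0 x; first exact: pos x0.
have -> : h x = (h \o -%R) (- x) by rewrite /= opprK.
rewrite -(normrN x); apply: (pos _ (fun y => - dh (- y))); last first.
- by rewrite oppr_ge0.
- by move=> y; rewrite normrN -(normrN y).
- by rewrite /= oppr0.
- move=> y; apply: trigger_derive.
  by rewrite mulrN1.
Qed.

(** Simultaneous induction: each remainder is, up to sign, an antiderivative of the other one at the
    previous order. At order 0 the zero polynomials suffice. *)
Lemma sin_cos_taylor k : exists p q,
  (forall x, `|sin x - p.[x]| <= `|x| ^+ k / k`!%:R) /\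
  (forall x, `|cos x - q.[x]| <= `|x| ^+ k / k`!%:R).
Proof.
elim: k => [|k [p [q [sp cq]]]].
  exists 0, 0; split => x; rewrite horner0 subr0 expr0 fact0 divr1 ler_norml.
    by rewrite sin_geN1 sin_le1.
  by rewrite cos_geN1 cos_le1.
have [ip dip ip0] := antiderivative_poly p.
have [iq diq iq0] := antiderivative_poly q.
exists iq, (1 - ip); split.
  apply: (@le_normr_antiderivative _ (fun x => cos x - q.[x])) => //.
    by move=> x; rewrite -diq; exact: is_deriveB.
  by rewrite sin0 iq0 subr0.
apply: (@le_normr_antiderivative _ (fun x => - (sin x - p.[x]))) => //.
- move=> x; apply: trigger_derive.
  by rewrite derivB derivC sub0r hornerN dip; ring.
- by rewrite cos0 !hornerE ip0; ring.
- by move=> x; rewrite normrN.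
Qed.

(** Two antiderivatives starting from [|sin| <= 1], through [1 - cos]. Bounded second moments will
    absorb the quadratic growth. *)
Lemma normr_sub_sin (x : R) : `|x - sin x| <= x ^+ 2 / 2.
Proof.
have c1 (y : R) : `|1 - cos y| <= `|y| ^+ 1 / 1`!%:R.
  apply: (@le_normr_antiderivative (fun y => 1 - cos y) sin 0).
  - by move=> z; rewrite -[sin z]opprK -sub0r; exact: is_deriveB.
  - by rewrite cos0 subrr.
  - by move=> z; rewrite expr0 fact0 divr1 ler_norml sin_geN1 sin_le1.
rewrite -[X in X / _]ger0_norm ?sqr_ge0// normrX (_ : 2 = 2`!%:R)//.
apply: (@le_normr_antiderivative (fun x => x - sin x)
  (fun x => 1 - cos x)) => //.
by rewrite sin0 subr0.
Qed.

End taylor.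

(** * A trigonometric partition of unity *)

Section euclidean_norm.
Context {R : realType} {d : nat}.
Implicit Types x y : 'rV[R]_d.

Lemma enorm_ge0 x : 0 <= enorm x.
Proof. exact: sqrtr_ge0. Qed.

Lemma enorm_le_l1 x : enorm x <= \sum_(j < d) `|x ord0 j|.
Proof.
set s := \sum_(j < d) _.
have s0 : 0 <= s by apply: sumr_ge0.
rewrite -[leRHS](ger0_norm s0) -sqrtr_sqr ler_wsqrtr// expr2 {1}/s mulr_suml.
apply: ler_sum => j _; rewrite -expr2 -real_normK ?num_real// expr2.
rewrite ler_wpM2l// /s (bigD1 j)//= lerDl; exact: sumr_ge0.
Qed.


Lemma dotZl (a : R) x y : dot (a *: x) y = a * dot x y.
Proof.
by rewrite /dot mulr_sumr; apply: eq_bigr => j _; rewrite !mxE mulrA.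
Qed.

Lemma dotDl x y z : dot (x + y) z = dot x z + dot y z.
Proof.
by rewrite /dot -big_split; apply: eq_bigr => j _; rewrite !mxE mulrDl.
Qed.

Lemma dot_delta j x : dot (delta_mx ord0 j) x = x ord0 j.
Proof.
rewrite /dot (bigD1 j)//= mxE !eqxx mul1r big1 ?addr0// => i ij.
by rewrite mxE (negbTE ij) andbF mul0r.
Qed.

Lemma enorm_delta (j : 'I_d) : enorm (delta_mx ord0 j : 'rV[R]_d) = 1.
Proof. by rewrite /enorm dot_delta mxE !eqxx sqrtr1. Qed.

Lemma enormZ (a : R) x : enorm (a *: x) = `|a| * enorm x.
Proof.
rewrite /enorm -sqrtr_sqr -sqrtrM ?sqr_ge0//; congr Num.sqrt.
rewrite /dot mulr_sumr; apply: eq_bigr => j _; rewrite !mxE; ring.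
Qed.

Lemma enorm_eq0 x : enorm x = 0 -> x = 0.
Proof.
move=> /eqP; rewrite sqrtr_eq0 => x0.
apply/rowP => j; rewrite mxE; apply/eqP; rewrite -sqrf_eq0 eq_le sqr_ge0 andbT.
apply: le_trans x0; rewrite /dot (bigD1 j)//= -expr2 lerDl.
by apply: sumr_ge0 => i _; rewrite -expr2 sqr_ge0.
Qed.

End euclidean_norm.

Section random_walk.
Context {R : realType} {X : Type} {d : nat}.
Variables (u : 'I_d -> X -> R) (C : (X -> R) -> Prop).
Hypothesis d_gt0 : (0 < d)%N.
Hypothesis u_le1 : forall j x, `|u j x| <= 1.
Hypothesis C1 : C (cst 1).
Hypothesis CM : forall f j a b, C f -> C (fun x => f x * (a + b * u j x)).

(** One step of the walk, with [D] the deviation along axis [l] before it. The step has mean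
    [v l / d] and second moment [1 / d] along [l], so the cross term cancels and the variance grows
    by [1 / d - (v l / d) ^ 2 <= 1]. *)
Let step_variance (v : 'I_d -> R) (l : 'I_d) (D : R) :
  \sum_(j < d) \sum_(b : bool)
    (d%:R^-1 / 2 + (-1) ^+ b * (d%:R^-1 / 2) * v j) *
    (D - v l / d%:R + (-1) ^+ b *+ (l == j)) ^+ 2 <= D ^+ 2 + 1.
Proof.
have dE : d%:R != 0 :> R by rewrite pnatr_eq0 -lt0n.
have sumC (c : R) : \sum_(j < d | j != l) c = d%:R * c - c.
  have : \sum_(j < d) c = d%:R * c by rewrite sumr_const card_ord mulr_natl.
  by rewrite (bigD1 l)//= => <-; rewrite [c + _]addrC addrK.
rewrite (bigD1 l)//= eqxx.
rewrite [X in _ + X](eq_bigr (fun=> (D - v l / d%:R) ^+ 2 / d%:R)).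
  rewrite sumC big_bool/= expr1 expr0 !mulr1n.
  rewrite [leLHS](_ : _ = D ^+ 2 + d%:R^-1 - (v l / d%:R) ^+ 2); last by field.
  rewrite lerBlDr -addrA lerD2l (le_trans (y := 1))// ?lerDl ?sqr_ge0//.
  by rewrite invf_le1 ?ltr0n// ler1n.
move=> j /negbTE lj; rewrite big_bool/= eq_sym lj !mulr0n !addr0 expr1 expr0.
by field.
Qed.

(** [I] enumerates the paths of [N] steps, [chi k x] is the probability of path [k] under the bias
    given by [x], and [S k] is its endpoint. Each step multiplies [chi] by a factor affine in one
    [u j], whence the closure hypothesis on [C]. *)
Lemma walk_partition N : exists (I : finType) (chi : I -> X -> R)
    (S : I -> 'I_d -> R),
  [/\ forall k, C (chi k), forall k x, 0 <= chi k x,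
      forall x, \sum_k chi k x = 1 &
      forall x l, \sum_k chi k x * (S k l - N%:R * u l x / d%:R) ^+ 2 <= N%:R].
Proof.
elim: N => [|N [I [chi [S [Cchi chi0 chi1 chiv]]]]].
  exists unit, (fun=> cst 1), (fun _ _ => 0); split=> //.
    by move=> x; rewrite sumr_const card_unit.
  by move=> x l; rewrite big1// => k _; rewrite !mul0r subrr expr0n mulr0.
exists (I * ('I_d * bool))%type,
  (fun (k : I * ('I_d * bool)) x => chi k.1 x *
     (d%:R^-1 / 2 + (-1) ^+ k.2.2 * (d%:R^-1 / 2) * u k.2.1 x)),
  (fun (k : I * ('I_d * bool)) l => S k.1 l + (-1) ^+ k.2.2 *+ (l == k.2.1)).
split.
- by move=> k; exact: CM.
- move=> [k [j b]] x /=; rewrite mulr_ge0//.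
  have e0 : 0 <= d%:R^-1 / 2 :> R by rewrite divr_ge0.
  have := u_le1 j x; rewrite ler_norml => /andP[? ?].
  by case: b; rewrite ?expr1 ?expr0; nra.
- move=> x; rewrite -(pair_bigA _ (fun k (p : 'I_d * bool) => chi k x *
     (d%:R^-1 / 2 + (-1) ^+ p.2 * (d%:R^-1 / 2) * u p.1 x)))/=.
  rewrite -[RHS](chi1 x); apply: eq_bigr => k _; rewrite -mulr_sumr.
  rewrite -(pair_bigA _ (fun j (b : bool) =>
     (d%:R^-1 / 2 + (-1) ^+ b * (d%:R^-1 / 2) * u j x)))/=.
  rewrite (eq_bigr (fun=> d%:R^-1)).
    rewrite sumr_const card_ord -(mulr_natl d%:R^-1) mulfV ?mulr1//.
    by rewrite pnatr_eq0 -lt0n.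
  by move=> j _; rewrite big_bool/= expr1 expr0; field; rewrite pnatr_eq0 -lt0n.
- move=> x l.
  rewrite -(pair_bigA _ (fun k (p : 'I_d * bool) => chi k x *
     (d%:R^-1 / 2 + (-1) ^+ p.2 * (d%:R^-1 / 2) * u p.1 x) *
     (S k l + (-1) ^+ p.2 *+ (l == p.1) - N.+1%:R * u l x / d%:R) ^+ 2))/=.
  (* Writing the extra 1 as the sum of the [chi k x] reduces the bound to one step after each path
     [k]. *)
  rewrite -(natr1 N) -[X in _ <= _ + X](chi1 x) -lerBlDr -sumrB.
  apply: le_trans (chiv x l); apply: ler_sum => k _.
  rewrite lerBlDr -{3}[chi k x]mulr1 -mulrDr.
  rewrite -(pair_bigA _ (fun j (b : bool) => chi k x *
     (d%:R^-1 / 2 + (-1) ^+ b * (d%:R^-1 / 2) * u j x) *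
     (S k l + (-1) ^+ b *+ (l == j) - (N%:R + 1) * u l x / d%:R) ^+ 2))/=.
  apply: le_trans (ler_wpM2l (chi0 k x) (step_variance (u ^~ x) l _)).
  rewrite mulr_sumr ler_sum// => j _; rewrite mulr_sumr ler_sum// => b _.
  rewrite -mulrA le_eqVlt; apply/orP; left; apply/eqP.
  by do 3 congr (_ * _); rewrite mulrDl mul1r mulrDl; ring.
Qed.

End random_walk.

(* The walk of [walk_partition] driven by [u j x = sin (x_j / M)], rescaled by
   [M d / N], has mean [M sin (x_j / M)], which is close to [x_j] as
   [|y - sin y| <= y ^ 2 / 2], and variance at most [(M d) ^ 2 / N]. *)
Lemma sin_partition {R : realType} {d : nat} (C : ('rV[R]_d -> R) -> Prop)
    (M : R) (m : nat) : (0 < d)%N -> 0 < M -> (0 < m)%N -> C (cst 1) ->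
    (forall f v a b, C f -> C (fun x => f x * (a + b * sin (dot v x)))) ->
  exists (I : finType) (chi : I -> 'rV[R]_d -> R) (a : I -> 'rV[R]_d),
  [/\ forall k, C (chi k), forall k x, 0 <= chi k x,
      forall x, \sum_k chi k x = 1 &
      forall x, \sum_k chi k x * enorm (x - a k) <=
        \sum_(j < d) (x ord0 j ^+ 2 / (2 * M) + M * d%:R / m%:R)].
Proof.
move=> d0 M0 m0 C1 CM.
have mE : m%:R != 0 :> R by rewrite pnatr_eq0 -lt0n.
have ME : M != 0 by rewrite gt_eqF.
have dE : d%:R != 0 :> R by rewrite pnatr_eq0 -lt0n.
pose v j : 'rV[R]_d := M^-1 *: delta_mx ord0 j.
have vE j x : dot (v j) x = x ord0 j / M by rewrite dotZl dot_delta mulrC.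
have sin_le1' j x : `|sin (dot (v j) x)| <= 1.
  by rewrite ler_norml sin_geN1 sin_le1.
(* Taking [m ^ 2] steps makes the bound [M d / m] on the rescaled deviation free of square roots. *)
have [I [chi [S [Cchi chi0 chi1 chiv]]]] := walk_partition d0 sin_le1' C1
  (fun f j a b Cf => CM f (v j) a b Cf) (m ^ 2).
pose c := M * d%:R / m%:R ^+ 2.
have c0 : 0 <= c by rewrite /c divr_ge0 ?exprn_ge0// mulr_ge0// ltW.
exists I, chi, (fun k => \row_j (c * S k j)); split => // x.
pose D k j := S k j - (m ^ 2)%:R * sin (dot (v j) x) / d%:R.
(* AM-GM in place of Cauchy-Schwarz: as [D ^ 2] has mean at most [m ^ 2], each of the two halves
   averages to at most [m / 2]. *)
have D_le (y : R) : `|y| <= (m%:R + y ^+ 2 / m%:R) / 2.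
  have m0R : 0 < m%:R :> R by rewrite ltr0n.
  rewrite ler_pdivlMr// -subr_ge0 -[y ^+ 2]real_normK ?num_real//.
  rewrite (_ : _ - _ = (m%:R - `|y|) ^+ 2 / m%:R); last by field.
  by rewrite divr_ge0 ?sqr_ge0.
have coord k j : `|(x - \row_j (c * S k j)) ord0 j| <=
    x ord0 j ^+ 2 / (2 * M) + c * `|D k j|.
  rewrite !mxE (_ : _ - _ = (x ord0 j - M * sin (x ord0 j / M)) - c * D k j).
    rewrite (le_trans (ler_normB _ _))// normrM (ger0_norm c0) lerD2r.
    rewrite (_ : _ - _ = M * (x ord0 j / M - sin (x ord0 j / M)));
      last by field.
    rewrite normrM.
    rewrite gtr0_norm// (le_trans (ler_wpM2l (ltW M0) (normr_sub_sin _)))//.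
    by rewrite le_eqVlt; apply/orP; left; apply/eqP; field.
  by rewrite /D /c vE natrX; field; rewrite dE mE.
rewrite (le_trans (y := \sum_k \sum_(j < d) chi k x *
  (x ord0 j ^+ 2 / (2 * M) + c * ((m%:R + D k j ^+ 2 / m%:R) / 2))))//.
  apply: ler_sum => k _; rewrite -mulr_sumr ler_wpM2l//.
  rewrite (le_trans (enorm_le_l1 _))// ler_sum// => j _.
  by rewrite (le_trans (coord k j))// lerD2l ler_wpM2l.
rewrite exchange_big/= ler_sum// => j _.
rewrite (eq_bigr (fun k => chi k x *
    (x ord0 j ^+ 2 / (2 * M) + c * m%:R / 2) +
    chi k x * D k j ^+ 2 * (c / m%:R / 2))); last first.
  by move=> k _; field; rewrite mE.
rewrite big_split/= -!mulr_suml chi1 mul1r -addrA lerD2l.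
have e0 : 0 <= c / m%:R / 2 by rewrite 2?divr_ge0 ?ler0n.
rewrite (le_trans (lerD (lexx _) (ler_wpM2r e0 (chiv x j))))// natrX /c.
by rewrite le_eqVlt; apply/orP; left; apply/eqP; field.
Qed.

(** * Limits, integrals and measurability *)

Lemma near_gt0 : \forall n \near \oo, (0 < n)%N.
Proof. by exists 1%N. Qed.

Section extended_limits.
Context {R : realType}.
Local Open Scope ereal_scope.

(** Eventual finiteness comes from the bound with [e = 1], so upper bounds alone give
    convergence. *)
Lemma ge0_cvge0P (u : nat -> \bar R) : (forall n, 0 <= u n) ->
  (u n @[n --> \oo] --> 0 <->
   forall e : R, (0 < e)%R -> \forall n \near \oo, u n <= e%:E).
Proof.
move=> u0; split.
  move=> /fine_cvgP[ufin /cvgrPdist_le u_0] e e0.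
  have := u_0 _ e0; apply: filterS2 ufin => n ufin.
  rewrite sub0r normrN -lee_fin; apply: le_trans.
  by rewrite -{1}(fineK ufin) lee_fin ler_norm.
move=> ue; apply/fine_cvgP; split.
  have := ue 1%R ltr01; apply: filterS => n un1.
  by rewrite ge0_fin_numE// (le_lt_trans un1) ?ltry.
apply/cvgrPdist_le => e e0; have := ue e e0; apply: filterS => n une.
rewrite sub0r normrN ger0_norm ?fine_ge0//.
have ufin : u n \is a fin_num.
  by rewrite ge0_fin_numE// (le_lt_trans une) ?ltry.
by rewrite -lee_fin fineK.
Qed.

End extended_limits.

Section integration.
Context {R : realType} {disp : measure_display} {T : measurableType disp}.
Variable mu : {measure set T -> \bar R}.
Local Open Scope ereal_scope.

(* No measurability: the integral is a supremum over simple functions below. *)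
Lemma le_integral_nneg (f g : T -> \bar R) : (forall x, 0 <= f x) ->
  (forall x, f x <= g x) -> \int[mu]_x f x <= \int[mu]_x g x.
Proof.
move=> f0 fg; have g0 x : 0 <= g x := le_trans (f0 x) (fg x).
rewrite !ge0_integralTE//; apply: ge_ereal_sup => _ [h hf <-].
by apply: ereal_sup_ubound; exists h => // x; rewrite (le_trans (hf x)).
Qed.

Lemma ge0_integral_linear (I : Type) (s : seq I) (a : I -> R)
    (f : I -> T -> R) :
  (forall i, 0 <= a i)%R -> (forall i, measurable_fun setT (f i)) ->
  (forall i x, 0 <= f i x)%R ->
  \int[mu]_x (\sum_(i <- s) a i * f i x)%:E =
  \sum_(i <- s) (a i)%:E * \int[mu]_x (f i x)%:E.
Proof.
move=> a0 mf f0; under eq_integral do rewrite -sumEFin.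
rewrite ge0_integral_sum//.
- apply: eq_bigr => i _; under eq_integral do rewrite EFinM.
  rewrite ge0_integralZl_EFin//; last exact/measurable_EFinP.
  by move=> x _; rewrite lee_fin.
- by move=> i; apply/measurable_EFinP; apply: measurable_funM.
- by move=> i x _; rewrite lee_fin mulr_ge0.
Qed.

End integration.

Lemma integral_probability_cst {R : realType} {disp : measure_display}
    {T : measurableType disp} (P : probability T R) (c : \bar R) :
  (\int[P]_x c)%E = c.
Proof. by rewrite integral_cst//= probability_setT mule1. Qed.

Lemma continuous_borel_measurable {R : realType} {d : nat} (f : 'rV[R]_d -> R) :
  continuous f -> measurable_fun [set: borel_rV R d] f.
Proof.
move=> /continuousP cf; apply: (measurability _ (RGenOpens.measurableE R)).
move=> _ [_ [a [b ->] <-]]; rewrite setTI.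
by apply: sub_sigma_algebra; exact/cf/interval_open.
Qed.

Section continuity.
Context {R : realType} {d : nat}.

Lemma continuous_dot (v : 'rV[R]_d) : continuous (dot v).
Proof.
apply: continuous_big => [|j _ x]; first exact: add_continuous.
by apply: continuousM; [exact: cst_continuous|exact: coord_continuous].
Qed.

Lemma measurable_dot (v : 'rV[R]_d) :
  measurable_fun [set: borel_rV R d] (dot v).
Proof. by apply: continuous_borel_measurable; exact: continuous_dot. Qed.

(** The topology is that of the sup norm. The Euclidean bound is weakened to the l1 distance to [x],
    which is visibly continuous and vanishes at [x]. *)
Lemma lipschitz1_continuous (f : 'rV[R]_d -> R) : lipschitz1 f -> continuous f.
Proof.
move=> f1 x; apply/(@cvgrPdist_le _ _ _ _ (nbhs_filter x)) => e e0.
have l1_cont :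
    continuous (fun y : 'rV[R]_d => \sum_(j < d) `|x ord0 j - y ord0 j|).
  apply: continuous_big => [|j _ y]; first exact: add_continuous.
  have yF := nbhs_filter y.
  by apply: cvg_norm; apply: cvgB; [exact: cvg_cst|exact: coord_continuous].
have /(@cvgrPdist_le _ _ _ _ (nbhs_filter x))/(_ e e0) := l1_cont x.
apply: filterS => y.
rewrite [X in X - _]big1 => [|j _]; last by rewrite subrr normr0.
rewrite sub0r normrN; apply: le_trans; apply: le_trans (ler_norm _).
rewrite (le_trans (f1 _ _))// (le_trans (enorm_le_l1 _))// ler_sum// => j _.
by rewrite !mxE.
Qed.

End continuity.

(** * Concentration of empirical means *)

Section empirical_mean.
Context {R : realType} {d n : nat} {disp : measure_display}
  {T : measurableType disp} {P : probability T R}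
  (Y : 'I_n -> {RV P >-> borel_rV R d}).
Implicit Types (f g : 'rV[R]_d -> R) (c : R).

Definition emp_mean g (w : T) : R := n%:R^-1 * \sum_(i < n) g (Y i w).

Definition mean_dev g c : \bar R := (\int[P]_w (`|emp_mean g w - c|)%:E)%E.

Lemma measurable_RV g i : measurable_fun [set: borel_rV R d] g ->
  measurable_fun [set: T] (fun w => g (Y i w)).
Proof. by move=> mg; exact: measurableT_comp. Qed.

Lemma measurable_emp_mean g : measurable_fun [set: borel_rV R d] g ->
  measurable_fun [set: T] (emp_mean g).
Proof.
move=> mg; apply: measurable_funM => //; apply: measurable_sum => i.
exact: measurable_RV.
Qed.

Lemma emp_mean_ge0 g w : (forall x, 0 <= g x) -> 0 <= emp_mean g w.
Proof. by move=> g0; rewrite mulr_ge0 ?invr_ge0// sumr_ge0. Qed.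

Lemma le_emp_mean f g w : (forall x, f x <= g x) ->
  emp_mean f w <= emp_mean g w.
Proof. by move=> fg; rewrite ler_wpM2l ?invr_ge0// ler_sum. Qed.

(** For [n = 0] the empirical mean is 0 by the convention on inverses, hence the hypothesis. *)
Lemma emp_mean_cst c w : (0 < n)%N -> emp_mean (cst c) w = c.
Proof.
move=> n0; rewrite /emp_mean sumr_const card_ord -(mulr_natl c) mulKf//.
by rewrite pnatr_eq0 -lt0n.
Qed.

Lemma emp_meanZ a f w : emp_mean (fun x => a * f x) w = a * emp_mean f w.
Proof. by rewrite /emp_mean -mulr_sumr mulrCA. Qed.

Lemma emp_meanD f g w :
  emp_mean (fun x => f x + g x) w = emp_mean f w + emp_mean g w.
Proof. by rewrite /emp_mean big_split mulrDr. Qed.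

Lemma emp_meanB f g w :
  emp_mean (fun x => f x - g x) w = emp_mean f w - emp_mean g w.
Proof. by rewrite /emp_mean sumrB mulrBr. Qed.

Lemma emp_mean_sum (I : Type) (s : seq I) (F : I -> 'rV[R]_d -> R) w :
  emp_mean (fun x => \sum_(k <- s) F k x) w = \sum_(k <- s) emp_mean (F k) w.
Proof. by rewrite /emp_mean exchange_big mulr_sumr. Qed.

Lemma ler_norm_emp_mean f w : `|emp_mean f w| <= emp_mean (fun x => `|f x|) w.
Proof.
rewrite /emp_mean normrM ger0_norm ?invr_ge0//.
by rewrite ler_wpM2l ?invr_ge0// ler_norm_sum.
Qed.

Lemma measurable_dev g c : measurable_fun [set: borel_rV R d] g ->
  measurable_fun [set: T] (fun w => `|emp_mean g w - c|).
Proof.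
move=> mg; apply: measurableT_comp => //.
by apply: measurable_funB => //; exact: measurable_emp_mean.
Qed.

Local Open Scope ereal_scope.

Lemma le_integral_emp_mean g c : (0 < n)%N ->
  measurable_fun [set: borel_rV R d] g -> (forall x, 0 <= g x)%R ->
  (forall i, \int[P]_w (g (Y i w))%:E <= c%:E) ->
  \int[P]_w (emp_mean g w)%:E <= c%:E.
Proof.
move=> n0 mg g0 gc; under eq_integral do rewrite /emp_mean mulr_sumr.
rewrite (ge0_integral_linear _ _ (a := fun=> n%:R^-1%R)
  (f := fun i w => g (Y i w)))//; last by move=> i; exact: measurable_RV.
apply: (@le_trans _ _ (\sum_(i < n) (n%:R^-1)%:E * c%:E)).
  by apply: lee_sum => i _; rewrite lee_pmul2l// lte_fin invr_gt0 ltr0n.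
under eq_bigr do rewrite -EFinM.
rewrite sumEFin lee_fin sumr_const card_ord -(mulr_natl (_ * c)%R) mulrA.
by rewrite mulfV ?mul1r// pnatr_eq0 -lt0n.
Qed.

Lemma mean_dev_linear f g a b c1 c2 : measurable_fun [set: borel_rV R d] f ->
  measurable_fun [set: borel_rV R d] g ->
  mean_dev (fun x => a * f x + b * g x)%R (a * c1 + b * c2) <=
  `|a|%:E * mean_dev f c1 + `|b|%:E * mean_dev g c2.
Proof.
move=> mf mg; rewrite /mean_dev.
have mdf := measurable_dev c1 mf; have mdg := measurable_dev c2 mg.
rewrite -!ge0_integralZl_EFin//; try exact/measurable_EFinP.
rewrite -ge0_integralD//; last 2 first.
- by apply: measurable_funeM; exact/measurable_EFinP.
- by apply: measurable_funeM; exact/measurable_EFinP.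
apply: le_integral_nneg => w; first by rewrite lee_fin.
rewrite emp_meanD !emp_meanZ -!EFinM -EFinD lee_fin -!normrM.
rewrite (le_trans _ (ler_normD _ _))// !mulrBr le_eqVlt; apply/orP; left.
by apply/eqP; congr `| _ |%R; ring.
Qed.

Lemma mean_dev_approx f g c e : (0 < n)%N ->
  measurable_fun [set: borel_rV R d] f ->
  measurable_fun [set: borel_rV R d] g ->
  (forall i, \int[P]_w (`|f (Y i w) - g (Y i w)|)%:E <= e%:E) ->
  mean_dev f c <= mean_dev g c + e%:E.
Proof.
move=> n0 mf mg fge; rewrite /mean_dev.
have mfg : measurable_fun [set: borel_rV R d] (fun x => `|f x - g x|)%R.
  by apply: measurableT_comp => //; exact: measurable_funB.
apply: le_trans (leeD2l _ (le_integral_emp_mean (g := fun x => `|f x - g x|%R)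
   n0 mfg _ fge)) => //.
rewrite -ge0_integralD//; last 3 first.
- by apply/measurable_EFinP; exact: measurable_dev.
- by move=> w _; rewrite lee_fin emp_mean_ge0.
- by apply/measurable_EFinP; exact: measurable_emp_mean.
apply: le_integral_nneg => w; first by rewrite lee_fin.
rewrite -EFinD lee_fin (le_trans _ (lerD (lexx _) (ler_norm_emp_mean _ _)))//.
rewrite (le_trans _ (ler_normD _ _))// le_eqVlt; apply/orP; left; apply/eqP.
by rewrite emp_meanB; congr `| _ |%R; ring.
Qed.

End empirical_mean.

Section concentration.
Context {R : realType} {d : nat} {disp : nat -> measure_display}
  {T : forall n : nat, measurableType (disp n)}
  {P : forall n : nat, probability (T n) R}
  (Y : forall n : nat, 'I_n -> {RV (P n) >-> borel_rV R d}).
Arguments Y : clear implicits.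
Implicit Types f g : 'rV[R]_d -> R.

(* [c] stands for the mean of [g] under the expected measure, left unspecified
   so that no integrability is required of [g]. *)
Definition concentrated g := measurable_fun [set: borel_rV R d] g /\
  forall e : R, 0 < e ->
    \forall n \near \oo, exists c, (mean_dev (Y n) g c <= e%:E)%E.

Lemma concentrated_cst a : concentrated (cst a).
Proof.
split=> // e e0; apply: filterS near_gt0 => n n0; exists a.
rewrite /mean_dev integral0_eq ?lee_fin ?ltW// => w _.
by rewrite emp_mean_cst// subrr normr0.
Qed.

Lemma concentrated_linear f g a b : concentrated f -> concentrated g ->
  concentrated (fun x => a * f x + b * g x).
Proof.
move=> [mf cf] [mg cg]; split.
  by apply: measurable_funD; exact: measurable_funM.
move=> e e0.
have e20 : 0 < e / 2 by rewrite divr_gt0.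
(* Adding 1 keeps the divisors positive when [a] or [b] is 0. *)
have a1 : 0 < `|a| + 1 by rewrite ltr_wpDl.
have b1 : 0 < `|b| + 1 by rewrite ltr_wpDl.
have := cg (e / 2 / (`|b| + 1)) (divr_gt0 e20 b1).
have := cf (e / 2 / (`|a| + 1)) (divr_gt0 e20 a1).
apply: filterS2 => n [c1 fc1] [c2 gc2]; exists (a * c1 + b * c2).
apply: le_trans (mean_dev_linear _ _ _ _ _ mf mg) _.
rewrite [e]splitr EFinD leeD//.
- apply: le_trans (lee_pmul _ _ (lexx _) fc1) _; rewrite ?integral_ge0//.
  rewrite -EFinM lee_fin mulrCA ler_piMr ?(ltW e20)//.
  by rewrite ler_pdivrMr// mul1r lerDl.
- apply: le_trans (lee_pmul _ _ (lexx _) gc2) _; rewrite ?integral_ge0//.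
  rewrite -EFinM lee_fin mulrCA ler_piMr ?(ltW e20)//.
  by rewrite ler_pdivrMr// mul1r lerDl.
Qed.

Lemma concentrated_sum k (a : nat -> R) (F : nat -> 'rV[R]_d -> R) :
  (forall i, concentrated (F i)) ->
  concentrated (fun x => \sum_(i < k) a i * F i x).
Proof.
move=> cF; elim: k => [|k IHk].
  rewrite (_ : (fun _ => _) = cst 0); first exact: concentrated_cst.
  by apply/funext => x; rewrite big_ord0.
rewrite (_ : (fun _ => _) =
    (fun x => 1 * (\sum_(i < k) a i * F i x) + a k * F k x)).
  exact: concentrated_linear.
by apply/funext => x; rewrite big_ord_recr mul1r.
Qed.

(** The approximant depends on [e] but not on [n], so its own concentration can be used once it is
    fixed. *)
Lemma concentrated_approx f : measurable_fun [set: borel_rV R d] f ->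
  (forall e : R, 0 < e -> exists2 g, concentrated g &
    \forall n \near \oo, forall i,
      (\int[P n]_w (`|f (Y n i w) - g (Y n i w)|)%:E <= e%:E)%E) ->
  concentrated f.
Proof.
move=> mf approx; split=> // e e0.
have e20 : 0 < e / 2 by rewrite divr_gt0.
have [g [mg cg] fg] := approx _ e20.
have := cg _ e20; apply: filterS3 near_gt0 fg => n n0 fg [c gc]; exists c.
rewrite (le_trans (mean_dev_approx _ n0 mf mg fg))//.
by rewrite [e in leRHS]splitr EFinD leeD2r.
Qed.

Lemma concentrated_variance f : measurable_fun [set: borel_rV R d] f ->
  'V_(P n)[emp_mean (Y n) f] @[n --> \oo] --> 0%E -> concentrated f.
Proof.
move=> mf /ge0_cvge0P vf; split=> // e e0.
have e20 : 0 < e / 2 by rewrite divr_gt0.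
have := vf (fun n => variance_ge0 _ _) _ (exprn_gt0 2 e20).
apply: filterS => n Vn.
set c := fine 'E_(P n)[emp_mean (Y n) f].
exists c.
have mdev := measurable_emp_mean (Y n) mf.
(* [|y| <= e / 2 + y ^ 2 / (e / 2)] *)
apply: (@le_trans _ _ (\int[P n]_w ((e / 2)%:E +
    ((e / 2)^-1)%:E * ((emp_mean (Y n) f w - c) ^+ 2)%:E))%E).
  apply: le_integral_nneg => w; first by rewrite lee_fin.
  rewrite -EFinM -EFinD lee_fin -[in leRHS]real_normK ?num_real//.
  set y := `|_|; have y0 : 0 <= y := normr_ge0 _.
  have [ye|/ltW ye] := leP y (e / 2).
    by rewrite (le_trans ye)// lerDl mulr_ge0 ?sqr_ge0// invr_ge0 ltW.
  rewrite (le_trans (y := (e / 2)^-1 * y ^+ 2))//; last by rewrite lerDr ltW.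
  by rewrite mulrC ler_pdivlMr// expr2 ler_wpM2l.
rewrite ge0_integralD//; last 3 first.
- by move=> w _; rewrite lee_fin ltW.
- by move=> w _; rewrite -EFinM lee_fin mulr_ge0 ?sqr_ge0// invr_ge0 ltW.
- apply: measurable_funeM; apply/measurable_EFinP; apply: measurable_funX.
  exact: measurable_funB.
rewrite integral_probability_cst [e in leRHS]splitr EFinD leeD2l//.
rewrite ge0_integralZl_EFin//; last 3 first.
- by move=> w _; rewrite lee_fin sqr_ge0.
- apply/measurable_EFinP; apply: measurable_funX; exact: measurable_funB.
- by rewrite invr_ge0 ltW.
rewrite -lee_pdivlMl ?invr_gt0// invrK -EFinM -expr2 (le_trans _ Vn)//.
rewrite /c /variance covariance.unlock expectation.unlock.
under eq_integral do rewrite expr2.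
exact: lexx.
Qed.

End concentration.

(** [Psi r] contains the term of order [m], so an admissible [K] bounds the moment by
    [K ^ (2 m) m!]. The infimum may not be attained; the strict inequality [zeta < A] yields an
    admissible [K < A]. *)
Lemma Psi_norm_moment {R : realType} {disp : measure_display}
    {T : measurableType disp} (P : probability T R) (X : T -> R)
    (r zeta A : R) (m : nat) : measurable_fun setT X ->
  (0 < m)%N -> m%:R <= r / 2 -> (Psi_norm P r X <= zeta%:E)%E -> zeta < A ->
  (\int[P]_w (X w ^+ (2 * m))%:E <= (A ^+ (2 * m) * m`!%:R)%:E)%E.
Proof.
move=> mX m0 mr Xzeta zA.
have /ereal_inf_lt[_ [K [K0 EK] <-]] : (Psi_norm P r X < A%:E)%E.
  by rewrite (le_lt_trans Xzeta)// lte_fin.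
rewrite lte_fin => KA.
have A0 : 0 < A := lt_trans K0 KA.
have mPsi : measurable_fun setT (fun w => Psi r (`|X w| / K)).
  apply: measurable_sum => j; apply: measurable_funM => //.
  apply: measurable_funX; apply: measurable_funM => //.
  exact: measurableT_comp.
have term_ge0 w j : 0 <= (`|X w| / K) ^+ (2 * j) / j`!%:R.
  by rewrite divr_ge0// exprn_ge0// divr_ge0// ltW.
have Psi0 w : 0 <= Psi r (`|X w| / K) by apply: sumr_ge0 => j _.
have C0 : 0 <= A ^+ (2 * m) * m`!%:R by rewrite mulr_ge0// exprn_ge0// ltW.
apply: (@le_trans _ _ ((A ^+ (2 * m) * m`!%:R)%:E *
    \int[P]_w (Psi r (`|X w| / K))%:E)%E).
  rewrite -ge0_integralZl_EFin//; last exact/measurable_EFinP.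
    apply: le_integral_nneg => w; first by rewrite lee_fin mulnC exprM sqr_ge0.
    rewrite -EFinM lee_fin.
    rewrite (le_trans (y := (A ^+ (2 * m) * m`!%:R) *
        ((`|X w| / K) ^+ (2 * m) / m`!%:R)))//.
      rewrite mulrACA divff ?mulr1 ?pnatr_eq0 -?lt0n ?fact_gt0//.
      rewrite -exprMn !exprM ler_pXn2r ?nnegrE ?sqr_ge0//.
      rewrite -(real_normK (num_real (X w))) ler_pXn2r ?nnegrE//.
        by rewrite mulrCA ler_peMr// ler_pdivlMr// mul1r ltW.
      by rewrite mulr_ge0 ?divr_ge0// ltW.
    rewrite ler_wpM2l// /Psi (bigD1_seq m)/= ?iota_uniq ?lerDl ?sumr_ge0//.
    have r20 : 0 <= r / 2 by rewrite (le_trans _ mr).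
    by rewrite mem_index_iota m0 ltnS truncn_ge_nat.
  by move=> w _; rewrite lee_fin.
rewrite expectation.unlock in EK.
by rewrite -[leRHS]mule1 lee_wpmul2l// lee_fin.
Qed.

(** The quotient is a central binomial coefficient. This turns [m! / (2 m)!] into [1 / m!] in the
    Taylor remainder. *)
Lemma leq_sqr_fact m : (m`! * m`! <= (2 * m)`!)%N.
Proof.
have m2 : (m <= 2 * m)%N by rewrite leq_pmull.
by rewrite -(bin_fact m2) mul2n -addnn addnK leq_pmull// bin_gt0 leq_addr.
Qed.

(** * Concentration of trigonometric polynomials *)

Section trigonometric_concentration.
Context {R : realType} {d : nat} {disp : nat -> measure_display}
  {T : forall n : nat, measurableType (disp n)}
  {P : forall n : nat, probability (T n) R}
  {Y : forall n : nat, 'I_n -> {RV (P n) >-> borel_rV R d}}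
  (r : nat -> R).
Arguments Y : clear implicits.
Hypothesis r_cvg : r n @[n --> \oo] --> +oo.
Hypothesis proj_tails : forall theta : 'rV[R]_d, enorm theta = 1 ->
  exists zeta : R, forall n : nat, (1 <= n)%N ->
    (ereal_sup [set Psi_norm (P n) (r n) (fun w => dot theta (Y n i w))
               | i in [set: 'I_n]] <= zeta%:E)%E.
Hypothesis proj_moments : forall theta : 'rV[R]_d, enorm theta = 1 ->
  forall k : nat, (1 <= k)%N ->
    'V_(P n)[fun w => n%:R^-1 * \sum_(i < n) dot theta (Y n i w) ^+ k]
      @[n --> \oo] --> 0%E.

(** [A] is chosen before [m]; only the threshold on [n], past which [r n >= 2 m], depends on the
    order. *)
Lemma proj_moment_bound theta : enorm theta = 1 -> exists2 A : R, 0 < A &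
  forall m, (0 < m)%N -> \forall n \near \oo, forall i,
    (\int[P n]_w (dot theta (Y n i w) ^+ (2 * m))%:E <=
     (A ^+ (2 * m) * m`!%:R)%:E)%E.
Proof.
move=> /proj_tails[zeta tails]; exists (`|zeta| + 1); first by rewrite ltr_wpDl.
move=> m m0; move/cvgryPge : r_cvg => /(_ (2 * m%:R)).
apply: filterS2 near_gt0 => n n0 mr i.
apply: (@Psi_norm_moment _ _ _ _ _ (r n) zeta) => //.
- by apply: (measurable_RV (Y n)); exact: measurable_dot.
- by rewrite ler_pdivlMr// mulrC.
- apply: le_trans (tails _ n0); apply: ereal_sup_ubound; by exists i.
- by rewrite (le_lt_trans (ler_norm _))// ltrDl.
Qed.

Lemma concentrated_horner_dot theta (p : {poly R}) s : enorm theta = 1 ->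
  concentrated Y (fun x => p.[s * dot theta x]).
Proof.
move=> theta1.
rewrite (_ : (fun _ => _) = (fun x => \sum_(i < size p)
    (p`_i * s ^+ i) * dot theta x ^+ i)); last first.
  apply/funext => x; rewrite horner_coef; apply: eq_bigr => i _.
  by rewrite exprMn mulrA.
apply: (concentrated_sum _ (fun i => p`_i * s ^+ i)
  (F := fun i x => dot theta x ^+ i)) => -[|k].
  exact: (concentrated_cst Y 1).
apply: concentrated_variance; last exact: proj_moments.
by apply: measurable_funX; exact: measurable_dot.
Qed.

(** By [proj_moment_bound] the remainder of order [2 m] has mean at most [(s A) ^ (2 m) m! / (2 m)!
    <= (s A) ^ (2 m) / m!], a term of the exponential series at [(s A) ^ 2]. So [m] is fixed first,
    from [e], and then [n] is taken large. *)
Lemma concentrated_taylor (phi : R -> R) (t : 'rV[R]_d) : continuous phi ->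
  (forall k, exists p : {poly R}, forall y,
    `|phi y - p.[y]| <= `|y| ^+ k / k`!%:R) ->
  concentrated Y (fun x => phi (dot t x)).
Proof.
move=> cphi taylor.
(* The hypotheses concern unit vectors, and [t = 0] cannot be normalised. *)
have [/eqP/enorm_eq0 ->|t0] := boolP (enorm t == 0).
  rewrite (_ : (fun _ => _) = cst (phi 0)); first exact: concentrated_cst.
  by apply/funext => x; rewrite -(scale0r (0 : 'rV[R]_d)) dotZl mul0r.
pose s := enorm t; pose theta := s^-1 *: t.
have s0 : 0 < s by rewrite lt_def t0 enorm_ge0.
have theta1 : enorm theta = 1.
  by rewrite enormZ ger0_norm ?invr_ge0 ?enorm_ge0// mulVf.
have tE x : dot t x = s * dot theta x by rewrite -dotZl scalerA divff// scale1r.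
have [A A0 moments] := proj_moment_bound theta1.
have mphi : measurable_fun [set: borel_rV R d] (fun x => phi (dot t x)).
  apply: measurableT_comp; last exact: measurable_dot.
  exact: continuous_measurable_fun.
apply: concentrated_approx => // e e0.
have [m [m0 me]] : exists m,
    (0 < m)%N /\ `|0 - exp_coeff ((s * A) ^+ 2) m| <= e.
  apply: (@filter_ex _ \oo).
  move/cvgrPdist_le : (cvg_exp_coeff ((s * A) ^+ 2)) => /(_ e e0).
  by apply: filterS2 near_gt0 => m.
have [p pphi] := taylor (2 * m)%N.
exists (fun x => p.[s * dot theta x]); first exact: concentrated_horner_dot.
have := moments m m0; apply: filterS => n mom i.
pose C := s ^+ (2 * m) / (2 * m)`!%:R.
have C0 : 0 <= C by rewrite divr_ge0// exprn_ge0// ltW.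
apply: (@le_trans _ _
    (C%:E * \int[P n]_w (dot theta (Y n i w) ^+ (2 * m))%:E)%E).
  rewrite -ge0_integralZl_EFin//.
  - apply: le_integral_nneg => w; first by rewrite lee_fin.
    rewrite -EFinM lee_fin tE (le_trans (pphi _))//.
    rewrite normrM exprMn (gtr0_norm s0) [in leRHS]mulrAC ler_wpM2r//.
    by rewrite (exprM `|_|) real_normK ?num_real// -exprM.
  - by move=> w _; rewrite lee_fin exprM exprn_ge0// sqr_ge0.
  - apply/measurable_EFinP; apply: measurable_funX.
    by apply: (measurable_RV (Y n)); exact: measurable_dot.
rewrite (le_trans (y := (C%:E * (A ^+ (2 * m) * m`!%:R)%:E)%E))//.
  by rewrite lee_wpmul2l ?lee_fin.
rewrite -EFinM lee_fin (le_trans _ me)//.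
rewrite sub0r normrN (le_trans _ (ler_norm _))//.
rewrite /exp_coeff /= -exprM exprMn /C.
rewrite mulrACA ler_wpM2l ?mulr_ge0 ?exprn_ge0 ?(ltW s0) ?(ltW A0)//.
rewrite mulrC ler_pdivrMr ?ltr0n ?fact_gt0//.
rewrite mulrC ler_pdivlMr ?ltr0n ?fact_gt0//.
by rewrite -natrM ler_nat leq_sqr_fact.
Qed.

Lemma concentrated_cos t : concentrated Y (fun x => cos (dot t x)).
Proof.
apply: concentrated_taylor; first exact: continuous_cos.
by move=> k; have [_ [p [_ ?]]] := @sin_cos_taylor R k; exists p.
Qed.

Lemma concentrated_sin t : concentrated Y (fun x => sin (dot t x)).
Proof.
apply: concentrated_taylor; first exact: continuous_sin.
by move=> k; have [p [_ [? _]]] := @sin_cos_taylor R k; exists p.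
Qed.

(* Unlike [concentrated], visibly stable under multiplication by
   [sin (dot v x)]. *)
Definition trig_concentrated (f : 'rV[R]_d -> R) := forall t,
  concentrated Y (fun x => f x * cos (dot t x)) /\
  concentrated Y (fun x => f x * sin (dot t x)).

Lemma trig_concentrated1 : trig_concentrated (cst 1).
Proof.
by move=> t; split; under eq_fun do rewrite mul1r;
  [exact: concentrated_cos|exact: concentrated_sin].
Qed.

(** Product-to-sum formulas: the products with [cos (dot t x)] and [sin (dot t x)] only involve the
    frequencies [t], [v + t] and [v - t]. *)
Lemma trig_concentratedM f v a b : trig_concentrated f ->
  trig_concentrated (fun x => f x * (a + b * sin (dot v x))).
Proof.
move=> cf t; have dotB x : dot (v - t) x = dot v x - dot t x.
  by rewrite dotDl -scaleN1r dotZl mulN1r.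
have [[ct st] [cD sD] [cB sB]] := And3 (cf t) (cf (v + t)) (cf (v - t)).
split.
  rewrite (_ : (fun _ => _) = (fun x => a * (f x * cos (dot t x)) + 1 *
      (b / 2 * (f x * sin (dot (v + t) x)) +
       b / 2 * (f x * sin (dot (v - t) x))))).
    by apply: concentrated_linear => //; exact: concentrated_linear.
  by apply/funext => x; rewrite dotB dotDl sinD sinB; field.
rewrite (_ : (fun _ => _) = (fun x => a * (f x * sin (dot t x)) + 1 *
    (b / 2 * (f x * cos (dot (v - t) x)) +
     (- b / 2) * (f x * cos (dot (v + t) x))))).
  by apply: concentrated_linear => //; exact: concentrated_linear.
by apply/funext => x; rewrite dotB dotDl cosB cosD; field.
Qed.

Lemma trig_concentrated_concentrated f :
  trig_concentrated f -> concentrated Y f.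
Proof.
move=> /(_ 0)[+ _]; rewrite (_ : (fun _ => _) = f)//; apply/funext => x.
by rewrite -(scale0r (0 : 'rV[R]_d)) dotZl mul0r cos0 mulr1.
Qed.

End trigonometric_concentration.

(** * The Wasserstein distance *)

Section average_measure.
Context {R : realType} {disp : measure_display} {T : measurableType disp}
  {n : nat}.
Local Open Scope ereal_scope.

(** Serves both for the empirical measure, an average of Dirac masses, and for its mean, the average
    of the laws of the [Y i]. *)
Lemma ge0_integral_average (mu : {measure set T -> \bar R})
    (m : 'I_n -> {measure set T -> \bar R}) (g : T -> \bar R) :
  (forall A, measurable A -> mu A = (n%:R^-1)%:E * \sum_(i < n) m i A) ->
  measurable_fun setT g -> (forall x, 0 <= g x) ->
  \int[mu]_x g x = (n%:R^-1)%:E * \sum_(i < n) \int[m i]_x g x.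
Proof.
move=> muE mg g0.
(* [msum] takes a family indexed by [nat], so [m] is extended by the zero measure. *)
pose m_ k : {measure set T -> \bar R} := oapp m mzero (insub k).
have m_E (i : 'I_n) : m_ i = m i by rewrite /m_ valK.
have n0 : (0 <= n%:R^-1 :> R)%R by rewrite invr_ge0.
rewrite (eq_measure_integral (mscale (NngNum n0) (msum m_ n))).
  rewrite ge0_integral_mscale// ge0_integral_measure_sum//=.
  by under eq_bigr do rewrite m_E.
move=> A mA _; rewrite muE//; congr (_ * _).
by apply: eq_bigr => i _; rewrite m_E.
Qed.

End average_measure.

Lemma lipschitz1_measurable {R : realType} {d : nat} (f : 'rV[R]_d -> R) :
  lipschitz1 f -> measurable_fun [set: borel_rV R d] f.
Proof.
by move=> f1; apply: continuous_borel_measurable; exact: lipschitz1_continuous.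
Qed.

(** Lets the integrability proved in [W1_le] apply to the positive and negative parts of [f]
    separately. *)
Lemma lipschitz1_pos {R : realType} {d : nat} (f : 'rV[R]_d -> R) :
  lipschitz1 f -> lipschitz1 (fun x => Num.max (f x) 0).
Proof.
move=> f1 x y; apply: le_trans (f1 x y); move: (f x) (f y) => a b.
have := ler_norm (a - b); have := ler_norm (b - a); rewrite distrC.
move: `|a - b| => c ? ?; rewrite ler_norml.
by case: (leP a 0) => a0; case: (leP b 0) => b0; apply/andP; split; lra.
Qed.

Lemma lipschitz1N {R : realType} {d : nat} (f : 'rV[R]_d -> R) :
  lipschitz1 f -> lipschitz1 (fun x => - f x).
Proof. by move=> f1 x y; rewrite -opprD normrN. Qed.

Lemma integral_max {R : realType} {disp : measure_display}
    {T : measurableType disp} (mu : {measure set T -> \bar R}) (f : T -> R) :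
  (\int[mu]_x (f x)%:E = \int[mu]_x (Num.max (f x) 0)%:E -
                         \int[mu]_x (Num.max (- f x) 0)%:E)%E.
Proof.
rewrite integralE; congr (_ - _)%E; apply: eq_integral => x _.
  by rewrite funeposE EFin_max.
by rewrite funenegE -EFinN EFin_max.
Qed.

Lemma subr_max {R : realDomainType} (x : R) : Num.max x 0 - Num.max (- x) 0 = x.
Proof. by case: (leP x 0) => x0; case: (leP (- x) 0) => Nx0; lra. Qed.

Section wasserstein.
Context {R : realType} {d n : nat} {disp : measure_display}
  {T : measurableType disp} {P : probability T R}
  (Y : 'I_n -> {RV P >-> borel_rV R d}).
Implicit Types f g : 'rV[R]_d -> R.
Local Open Scope ereal_scope.

Lemma ge0_integral_random_empirical g w :
  measurable_fun [set: borel_rV R d] g -> (forall x, 0 <= g x)%R ->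
  \int[random_empirical_measure Y w]_x (g x)%:E = (emp_mean Y g w)%:E.
Proof.
move=> mg g0; have mEg : measurable_fun [set: borel_rV R d] (EFin \o g).
  exact/measurable_EFinP.
rewrite (ge0_integral_average (m := fun i => \d_(Y i w)))//.
rewrite /emp_mean EFinM -sumEFin; congr (_ * _); apply: eq_bigr => i _.
by rewrite integral_dirac// diracT mul1e.
Qed.

Lemma integral_random_empirical f w : measurable_fun [set: borel_rV R d] f ->
  \int[random_empirical_measure Y w]_x (f x)%:E = (emp_mean Y f w)%:E.
Proof.
move=> mf; rewrite integral_max !ge0_integral_random_empirical//.
- rewrite -EFinB -emp_meanB; congr (_ * _)%:E.
  by apply: eq_bigr => i _; rewrite subr_max.
- by apply: measurable_maxr => //; exact: measurableT_comp.
- by move=> x; rewrite le_max lexx orbT.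
- exact: measurable_maxr.
- by move=> x; rewrite le_max lexx orbT.
Qed.

Lemma ge0_integral_mean_empirical g :
  measurable_fun [set: borel_rV R d] g -> (forall x, 0 <= g x)%R ->
  \int[mean_empirical_measure Y]_x (g x)%:E = \int[P]_w (emp_mean Y g w)%:E.
Proof.
move=> mg g0; have mEg : measurable_fun [set: borel_rV R d] (EFin \o g).
  exact/measurable_EFinP.
have mgY i := measurable_RV Y i mg.
rewrite (ge0_integral_average (m := fun i => distribution P (Y i)))//.
- under [RHS]eq_integral do rewrite /emp_mean mulr_sumr.
  rewrite (ge0_integral_linear _ _ (a := fun=> n%:R^-1%R)
    (f := fun i w => g (Y i w)))//.
  rewrite ge0_sume_distrr => [|i _]; last first.
    by apply: integral_ge0 => x _; rewrite lee_fin.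
  by apply: eq_bigr => i _;
    rewrite ge0_integral_distribution// => x; rewrite lee_fin.
- move=> A mA; rewrite /= /mean_empirical_measure.
  have mdir i : measurable_fun [set: T] (fun w => \d_(Y i w) A : \bar R).
    exact: (measurableT_comp (measurable_fun_dirac mA)).
  rewrite ge0_integralZl_EFin//; first last.
  + exact: emeasurable_sum.
  + by move=> w _; exact: sume_ge0.
  rewrite ge0_integral_sum//; congr (_ * _); apply: eq_bigr => i _.
  have mYA : measurable (Y i @^-1` A).
    by rewrite -[_ @^-1` _]setTI; exact: measurable_funPT.
  rewrite /distribution /pushforward -[in RHS](setIT (_ @^-1` _)).
  by rewrite -integral_indic.
Qed.

(* The hypothesis on [G] is a bound that is uniform over all 1-Lipschitz
   functions. Integrating it over [w] puts the integral of [f] under the mean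
   measure within [\int[P]_w G w] of the same [K]. *)
Lemma W1_le (G : T -> R) w : measurable_fun setT G -> (forall w, 0 <= G w)%R ->
  \int[P]_w (G w)%:E < +oo ->
  (forall f, lipschitz1 f ->
     exists K, forall w, (`|emp_mean Y f w - K| <= G w)%R) ->
  W1 (random_empirical_measure Y w) (mean_empirical_measure Y) <=
  (G w)%:E + \int[P]_w (G w)%:E.
Proof.
move=> mG G0 Goo lipK.
(* Domination by [|K| + G]; it is needed to recombine the integrals of the two parts. *)
have intf f : lipschitz1 f -> P.-integrable setT (EFin \o emp_mean Y f).
  move=> f1; have mf := lipschitz1_measurable f1.
  have [K KG] := lipK f f1.
  apply: (@le_integrable _ _ _ P _ measurableT _
    (fun w => (`|K|)%:E + (G w)%:E)).
  - by apply/measurable_EFinP; exact: measurable_emp_mean.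
  - move=> x _; rewrite /= lee_fin (ger0_norm (addr_ge0 _ _))//.
    by rewrite -lerBlDl (le_trans (lerB_dist _ _))// KG.
  - apply: integrableD => //; first exact: finite_measure_integrable_cst.
    apply/integrableP; split; first exact/measurable_EFinP.
    by under eq_integral do rewrite gee0_abs ?lee_fin//.
apply: ge_ereal_sup => _ [f /= f1 <-].
have mf := lipschitz1_measurable f1.
rewrite integral_random_empirical// integral_max.
have maxr_ge0 (a : R) : (0 <= Num.max a 0)%R by rewrite le_max lexx orbT.
have p1 := lipschitz1_pos f1; have q1 := lipschitz1_pos (lipschitz1N f1).
rewrite !ge0_integral_mean_empirical//; try exact: lipschitz1_measurable.
rewrite -integralB_EFin//; try exact: intf.
rewrite [X in _ - X](_ : _ = \int[P]_x (emp_mean Y f x)%:E); last first.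
  apply: eq_integral => x _; rewrite -EFinB -emp_meanB; congr (_ * _)%:E.
  by apply: eq_bigr => i _; rewrite subr_max.
have [K KG] := lipK f f1.
(* Insert [K]: the first term is at most [G w], the second at most the integral of [G]. *)
rewrite (_ : _ - _ = (emp_mean Y f w - K)%:E -
    \int[P]_x ((emp_mean Y f x)%:E - K%:E)); last first.
  rewrite integralB//; [|exact: intf|exact: finite_measure_integrable_cst].
  rewrite integral_probability_cst EFinB.
  have := integrable_fin_num measurableT (intf f f1).
  by case: (\int[P]_x _) => // b _; rewrite -!EFinB; congr (_ %:E); ring.
apply: le_trans (lee_abs_sub _ _) _; apply: leeD; first by rewrite lee_fin.
apply: le_trans (le_abse_integral _ _ _) _ => //.
  apply/measurable_EFinP; apply: measurable_funB => //.
  exact: measurable_emp_mean.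
by apply: le_integral_nneg => x; rewrite ?abse_ge0// lee_fin.
Qed.

End wasserstein.

Section partition_bound.
Context {R : realType} {d : nat} {I : finType} (chi : I -> 'rV[R]_d -> R)
  (a : I -> 'rV[R]_d) (h : 'rV[R]_d -> R).
Hypothesis chi_ge0 : forall k x, 0 <= chi k x.
Hypothesis chi_sum : forall x, \sum_k chi k x = 1.
Hypothesis chi_h : forall x, \sum_k chi k x * enorm (x - a k) <= h x.
Context {n : nat} {disp : measure_display} {T : measurableType disp}
  {P : probability T R} (Y : 'I_n -> {RV P >-> borel_rV R d}).

(** Only [K] depends on [f]: the Lipschitz property bounds [f x - f (a k)] by [enorm (x - a k)],
    averaged into [h], and the coefficients [f (a k) - f 0] by [enorm (a k)]. *)
Lemma emp_mean_partition (c : I -> R) f : (0 < n)%N -> lipschitz1 f ->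
  exists K, forall w, `|emp_mean Y f w - K| <=
    emp_mean Y h w + \sum_k enorm (a k) * `|emp_mean Y (chi k) w - c k|.
Proof.
move=> n0 f1; exists (f 0 + \sum_k (f (a k) - f 0) * c k) => w.
rewrite (_ : _ - _ =
    emp_mean Y (fun x => f x - (f 0 + \sum_k (f (a k) - f 0) * chi k x)) w +
    \sum_k (f (a k) - f 0) * (emp_mean Y (chi k) w - c k)); last first.
  rewrite emp_meanB emp_meanD (emp_mean_cst Y _ w n0) emp_mean_sum.
  rewrite [X in _ = _ + X](eq_bigr (fun k => (f (a k) - f 0) *
    emp_mean Y (chi k) w - (f (a k) - f 0) * c k)); last by move=> k _; ring.
  rewrite sumrB.
  under [X in _ - (_ + X) + _]eq_bigr do rewrite emp_meanZ.
  by ring.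
apply: le_trans (ler_normD _ _) _; apply: lerD.
  apply: le_trans (ler_norm_emp_mean _ _ _) _; apply: le_emp_mean => x.
  apply: le_trans (chi_h x).
  (* The value [f 0] disappears because the [chi k x] sum to 1. *)
  rewrite (_ : _ - _ = \sum_k chi k x * (f x - f (a k))).
    apply: le_trans (ler_norm_sum _ _ _) _; apply: ler_sum => k _.
    by rewrite normrM ger0_norm// ler_wpM2l.
  rewrite [RHS](eq_bigr (fun k => chi k x * (f x - f 0) -
      (f (a k) - f 0) * chi k x)).
    by rewrite sumrB -[X in _ = X - _]mulr_suml chi_sum; ring.
  by move=> k _; ring.
apply: le_trans (ler_norm_sum _ _ _) _; apply: ler_sum => k _.
rewrite normrM ler_wpM2r// (le_trans (f1 _ _))// subr0; exact: lexx.
Qed.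

End partition_bound.

(** * Choice of the parameters and final estimate *)

Theorem theorem4 (R : realType) (d : nat) (d_ge1 : (1 <= d)%N)
    (disp : nat -> measure_display)
    (T : forall n : nat, measurableType (disp n))
    (P : forall n : nat, probability (T n) R)
    (Y : forall n : nat, 'I_n -> {RV (P n) >-> borel_rV R d})
    (r : nat -> R)
    (r_ge2 : forall n : nat, (1 <= n)%N -> 2 <= r n)
    (r_cvg : r n @[n --> \oo] --> +oo)
    (proj_tails : forall theta : 'rV[R]_d, enorm theta = 1 ->
      exists zeta : R, forall n : nat, (1 <= n)%N ->
        (ereal_sup [set Psi_norm (P n) (r n) (fun w => dot theta (Y n i w))
                   | i in [set: 'I_n]] <= zeta%:E)%E)
    (proj_moments : forall theta : 'rV[R]_d, enorm theta = 1 ->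
      forall k : nat, (1 <= k)%N ->
        'V_(P n)[fun w => n%:R^-1 * \sum_(i < n) dot theta (Y n i w) ^+ k]
          @[n --> \oo] --> 0%E)
    (first_moment :
      (ereal_sup [set M1 (mean_empirical_measure (Y n))
                 | n in [set n : nat | (1 <= n)%N]] < +oo)%E) :
  (\int[P n]_w W1 (random_empirical_measure (Y n) w)
                  (mean_empirical_measure (Y n)))%E
    @[n --> \oo] --> 0%E.
Proof.
have W1_ge0 n w : (0 <= W1 (random_empirical_measure (Y n) w)
    (mean_empirical_measure (Y n)))%E.
  apply: (@le_trans _ _ _ _ _ (abse_ge0 _) (ereal_sup_ubound _)).
  by exists (cst 0) => //= x y; rewrite subrr normr0 enorm_ge0.
apply/ge0_cvge0P => [n|e' e'0]; first by apply: integral_ge0.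
(* [G] will have integral at most [2 e], and it is counted twice in [W1_le]. *)
pose e := e' / 4.
have e0 : 0 < e by rewrite divr_gt0.
have [A moments] : exists A : 'I_d -> R, forall j,
    \forall n \near \oo, forall i,
    (\int[P n]_w (Y n i w ord0 j ^+ 2)%:E <= (A j ^+ 2)%:E)%E.
  apply: (@fin_all_exists _ _ (fun j a => \forall n \near \oo, forall i,
    (\int[P n]_w (Y n i w ord0 j ^+ 2)%:E <= (a ^+ 2)%:E)%E)) => j.
  have [a _ /(_ 1%N isT)] := proj_moment_bound r_cvg proj_tails (enorm_delta j).
  rewrite muln1 -[1`!]/1%N mulr1 => mom; exists a.
  apply: filterS mom => n mom i.
  by have := mom i; under eq_integral do rewrite dot_delta.
pose S := \sum_(j < d) A j ^+ 2.
have S0 : 0 <= S by apply: sumr_ge0 => j _; rewrite sqr_ge0.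
(* Makes [S / (2 M) <= e / 2], and is positive even if [S = 0]. The choice of [m] bounds the other
   part of the mean of [h], namely [d (M d / m)], by [e / 2]. *)
pose M := S / e + 1.
have M0 : 0 < M by rewrite ltr_wpDl// divr_ge0// ltW.
pose m := (Num.truncn (2 * d%:R * M * d%:R / e)).+1.
have mM : M * d%:R / m%:R * d%:R <= e / 2.
  have m0R : 0 < m%:R :> R by rewrite ltr0n.
  have : 2 * d%:R * M * d%:R / e < m%:R by exact: truncnS_gt.
  by rewrite ltr_pdivrMr// => ?; rewrite mulrAC ler_pdivrMr//; lra.
have M20 : 0 <= 2 * M by rewrite mulr_ge0// ltW.
have c0 : 0 <= M * d%:R / m%:R by rewrite divr_ge0// mulr_ge0// ltW.
have [I [chi [a [Cchi chi0 chi1 chih]]]] := sin_partition d_ge1 M0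
  (ltn0Sn _ : 0 < m)%N (trig_concentrated1 r_cvg proj_tails proj_moments)
  (fun f v a b => @trig_concentratedM _ _ _ _ _ Y f v a b).
pose h (x : 'rV[R]_d) :=
  \sum_(j < d) (x ord0 j ^+ 2 / (2 * M) + M * d%:R / m%:R).
have conc k : concentrated Y (chi k) := trig_concentrated_concentrated (Cchi k).
(* With deviations at most [e / B], the sum weighted by [enorm (a k)] stays below [e]. *)
pose B := \sum_k enorm (a k) + 1.
have B0 : 0 < B by rewrite ltr_wpDl// sumr_ge0// => k _; exact: enorm_ge0.
(* As [I] is finite and was fixed before [n], one threshold serves all [k]. *)
have near_dev : \forall n \near \oo, forall k, exists c,
    (mean_dev (Y n) (chi k) c <= (e / B)%:E)%E.
  by apply: filter_forall => k; exact: (conc k).2 _ (divr_gt0 e0 B0).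
have near_mom := filter_forall eventually_filter moments.
apply: filterS3 near_gt0 near_mom near_dev => n n0 mom dev.
have [c devc] := fin_all_exists dev.
have mh : measurable_fun [set: borel_rV R d] h.
  apply: measurable_sum => j; apply: measurable_funD => //.
  apply: measurable_funM => //; apply: measurable_funX.
  by apply: continuous_borel_measurable; exact: coord_continuous.
have h0 x : 0 <= h x.
  by apply: sumr_ge0 => j _; rewrite addr_ge0// divr_ge0 ?sqr_ge0.
have mY2 i j : measurable_fun setT (fun w => Y n i w ord0 j ^+ 2).
  apply: measurable_funX; apply: (measurable_RV (Y n) (g := fun x => x ord0 j)).
  by apply: continuous_borel_measurable; exact: coord_continuous.
have hY i : (\int[P n]_w (h (Y n i w))%:E <= e%:E)%E.
  under eq_integral do rewrite -sumEFin.
  rewrite ge0_integral_sum//; last 2 first.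
  - by move=> j; apply/measurable_EFinP; apply: measurable_funD => //;
      exact: measurable_funM.
  - by move=> j w _; rewrite lee_fin addr_ge0// divr_ge0 ?sqr_ge0.
  apply: (@le_trans _ _ (\sum_(j < d)
      (A j ^+ 2 / (2 * M) + M * d%:R / m%:R)%:E)%E).
    apply: lee_sum => j _; under eq_integral do rewrite EFinD mulrC EFinM.
    rewrite ge0_integralD//; last 2 first.
    + by move=> w _; rewrite -EFinM lee_fin mulr_ge0 ?sqr_ge0 ?invr_ge0//.
    + by apply: measurable_funeM; apply/measurable_EFinP; exact: mY2.
    rewrite integral_probability_cst EFinD leeD2r//.
    rewrite ge0_integralZl_EFin//; last 3 first.
    + by move=> w _; rewrite lee_fin sqr_ge0.
    + by apply/measurable_EFinP; exact: mY2.
    + by rewrite invr_ge0.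
    rewrite (mulrC (A j ^+ 2)) EFinM; apply: lee_wpmul2l; last exact: mom.
    by rewrite lee_fin invr_ge0.
  rewrite sumEFin lee_fin big_split/= -mulr_suml sumr_const card_ord.
  rewrite -(mulr_natr (M * d%:R / m%:R)) [e]splitr lerD//.
  have SE : S = (M - 1) * e by rewrite /M addrK divfK// gt_eqF.
  by rewrite -/S ler_pdivrMr ?mulr_gt0//; nra.
pose G w := emp_mean (Y n) h w +
  \sum_k enorm (a k) * `|emp_mean (Y n) (chi k) w - c k|.
have mdev k := measurable_dev (Y n) (c k) (conc k).1.
have mG : measurable_fun setT G.
  apply: measurable_funD; first exact: measurable_emp_mean.
  by apply: measurable_sum => k; apply: measurable_funM.
have G0 w : 0 <= G w.
  rewrite addr_ge0 ?emp_mean_ge0// sumr_ge0// => k _.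
  by rewrite mulr_ge0// enorm_ge0.
have Ge : (\int[P n]_w (G w)%:E <= (e + e)%:E)%E.
  under eq_integral do rewrite EFinD.
  rewrite ge0_integralD//=; last 4 first.
  - by move=> w _; rewrite lee_fin emp_mean_ge0.
  - by apply/measurable_EFinP; exact: measurable_emp_mean.
  - move=> w _; rewrite lee_fin sumr_ge0// => k _.
    by rewrite mulr_ge0// enorm_ge0.
  - apply/measurable_EFinP; apply: measurable_sum => k.
    exact: measurable_funM.
  rewrite EFinD leeD//; first exact: le_integral_emp_mean.
  rewrite ge0_integral_linear//; last by move=> k; exact: enorm_ge0.
  apply: (@le_trans _ _ (\sum_k (enorm (a k))%:E * (e / B)%:E)%E).
    by apply: lee_sum => k _; apply: lee_wpmul2l; rewrite ?lee_fin ?enorm_ge0//;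
      exact: devc.
  under eq_bigr do rewrite -EFinM.
  rewrite sumEFin lee_fin -mulr_suml mulrCA ler_piMr ?(ltW e0)//.
  by rewrite ler_pdivrMr// mul1r lerDl.
have W1G w := W1_le (Y := Y n) w mG G0 (le_lt_trans Ge (ltry _))
  (fun f => emp_mean_partition chi0 chi1 (h := h) chih (Y n) c n0).
apply: le_trans (le_integral_nneg _ (W1_ge0 n) W1G) _.
rewrite ge0_integralD//=; last 3 first.
- by move=> w _; rewrite lee_fin.
- exact/measurable_EFinP.
- by move=> w _; apply: integral_ge0 => x _; rewrite lee_fin.
rewrite integral_probability_cst (le_trans (leeD Ge Ge))// -EFinD lee_fin.
by rewrite /e; lra.
Qed.
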